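(* Let $A_0,A_1,\ldots$ be independent and identically distributed complex random variables, and let $Y_n:=\max_{0\le k\le n}|A_k|$. If $\mu:=\mathbb{E}[|A_0|^t]<\infty$, where $t>0$, then $$\mathbb{E}[\log Y_n]\le\frac{\log(n+1)+\log\mu}{t}.$$ *)

(* Defs.v *)
From HB Require Import structures.
From mathcomp Require Import all_boot all_order all_algebra finmap.
From mathcomp Require Import complex.
From mathcomp Require Import all_classical all_reals all_analysis.

Set Implicit Arguments.
Unset Strict Implicit.
Unset Printing Implicit Defensive.

Import Order.TTheory GRing.Theory Num.Theory.
Import numFieldTopology.Exports numFieldNormedType.Exports.

Local Open Scope classical_set_scope.
Local Open Scope ring_scope.

(* The complex plane with its Borel sigma-algebra; the open sets are those of
   the topology MathComp-Analysis puts on any numFieldType, i.e. the one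
   induced by the modulus. *)
Definition borelC (R : realType) :=
  g_sigma_algebraType (open : set (set (R[i])^o)).

HB.instance Definition _ (R : realType) := Measurable.on (borelC R).

Section iid.
Context {d d' : measure_display} {T : measurableType d}
  {T' : measurableType d'} {R : realType} (P : probability T R).

Definition mutually_independent (I : choiceType) (X : I -> {RV P >-> T'}) :=
  forall (J : {fset I}) (B : I -> set T'),
    (forall i, i \in J -> measurable (B i)) ->
    P (\bigcap_(i in [set` J]) (X i @^-1` B i)) =
    (\prod_(i <- J) P (X i @^-1` B i))%E.

Definition identically_distributed (I : Type) (X : I -> {RV P >-> T'}) :=
  forall (i j : I) (B : set T'), measurable B ->
    distribution P (X i) B = distribution P (X j) B.

Definition iid (I : choiceType) (X : I -> {RV P >-> T'}) :=
  mutually_independent X /\ identically_distributed X.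

End iid.

Arguments mutually_independent {d d' T T' R} P {I} X.
Arguments identically_distributed {d d' T T' R} P {I} X.
Arguments iid {d d' T T' R} P {I} X.

(* Main.v *)
Require Import Defs.
From mathcomp Require Import all_boot all_order all_algebra finmap.
From mathcomp Require Import complex.
From mathcomp Require Import all_classical all_reals all_analysis.
From mathcomp Require Import measurable_realfun.
From mathcomp Require Import ring.

(** Jensen's inequality for the logarithm says that [E (log Z) <= log (E Z)]
for [Z := Y ^ t], and [Z], being the largest of the [|A_k| ^ t], is at most
their sum, whose expectation is [(n + 1) * mu] because the [A_k] all have the
law of [A_0].  Dividing by [t] gives the claim.

The concavity of the logarithm is used in the form of its tangent line at a
point [c > 0]: [log z <= z / c - 1 + log c] ([ln_le_tangent]).  Integrating this
bound for any [c] with [(n + 1) * mu <= c] yields [E (log Y) <= log c / t]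
([expectation_log_max_le]), and in passing shows that the positive part of
[log Y] is integrable, as it lies below an integrable function.  If [mu > 0],
take [c = (n + 1) * mu].  If [mu = 0], every [c > 0] is admissible, and letting
[c] tend to [0] shows that [E (log Y)] is [-oo], which is then the value of the
right-hand side; this spares an almost-everywhere argument for the vanishing of
the [A_k]. *)

Import Order.TTheory GRing.Theory Num.Theory.
Import numFieldTopology.Exports numFieldNormedType.Exports.

Local Open Scope classical_set_scope.
Local Open Scope ring_scope.
Local Open Scope ereal_scope.

Lemma normc_ge0 (R : realType) (z : R[i]) : (0 <= Normc.normc z)%R.
Proof. by case: z => x y; exact: sqrtr_ge0. Qed.

Lemma measurable_normc (R : realType) :
  measurable_fun [set: borelC R] (fun z => Normc.normc z : R).
Proof.
apply: (measurability _ (RGenInftyO.measurableE R)) => // _ [_ [x ->] <-].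
rewrite setTI; apply: sub_sigma_algebra.
(* The preimage of a left-infinite ray is an open disc centred at the origin,
   empty when the ray ends at a nonpositive number. *)
rewrite (_ : _ @^-1` _ = ball (0%R : (R[i])^o) x%:C%C); first exact: ball_open.
apply/seteqP; split => z /=; rewrite -ball_normE /= sub0r normrN in_itv /=.
all: by rewrite -[(`|z|)%R]/((Normc.normc z)%:C)%C ltcR.
Qed.

(** The integral of a nonnegative function is a supremum over the simple
functions below it, and enlarging the function can only add competitors to this
supremum. *)
Lemma ge0_le_integral_nonmeasurable d (T : measurableType d) (R : realType)
    (m : {measure set T -> \bar R}) (f g : T -> \bar R) :
  (forall x, 0 <= f x) -> (forall x, f x <= g x) ->
  \int[m]_x f x <= \int[m]_x g x.
Proof.
move=> f0 fg; have g0 x : 0 <= g x by exact: le_trans (fg x).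
rewrite !ge0_integralTE//; apply: le_ereal_sup => _ [h hf <-].
by exists h => // x; exact: le_trans (fg x).
Qed.

Lemma le_integral_nonmeasurable d (T : measurableType d) (R : realType)
    (m : {measure set T -> \bar R}) (f g : T -> \bar R) :
  (forall x, f x <= g x) -> \int[m]_x f x <= \int[m]_x g x.
Proof.
move=> fg; rewrite integralE [leRHS]integralE; apply: leeB.
- apply: ge0_le_integral_nonmeasurable => x; first exact: funepos_ge0.
  by apply: (@funepos_le _ _ setT) => [? _|]; rewrite ?inE.
- apply: ge0_le_integral_nonmeasurable => x; first exact: funeneg_ge0.
  by apply: (@funeneg_le _ _ setT) => [? _|]; rewrite ?inE.
Qed.

Lemma ln_le_tangent (R : realType) (c z : R) :
  (0 < c)%R -> (0 < z)%R -> (ln z <= z / c - 1 + ln c)%R.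
Proof.
move=> c0 z0; have zc0 : (0 < z / c)%R by exact: divr_gt0.
rewrite -lerBlDr -ln_div ?posrE//.
have := @le_ln1Dx R (z / c - 1); rewrite subrKC; apply.
by rewrite ltrBrDl subrr.
Qed.

Lemma ge0_integral_identically_distributed d d' (T : measurableType d)
    (T' : measurableType d') (R : realType) (P : probability T R) (I : Type)
    (X : I -> {RV P >-> T'}) (h : T' -> \bar R) (i j : I) :
  identically_distributed P X ->
  measurable_fun [set: T'] h -> (forall z, 0 <= h z) ->
  \int[P]_w h (X i w) = \int[P]_w h (X j w).
Proof.
move=> idX mh h0.
have E k : \int[P]_w h (X k w) = \int[distribution P (X k)]_z h z.
  by rewrite ge0_integral_distribution.
by rewrite !E; apply: eq_measure_integral => B mB _; exact: idX.
Qed.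

Lemma measurable_powR_normc (R : realType) (t : R) :
  measurable_fun [set: borelC R] (fun z => (Normc.normc z `^ t)%:E : \bar R).
Proof.
apply/measurable_EFinP; apply: (measurableT_comp (measurable_powR t)).
exact: measurable_normc.
Qed.

(** The constant [c] stays a parameter, so that it can either equal
[(n + 1) * E (|A_0| ^ t)] or, when this vanishes, be arbitrarily small. *)
Lemma expectation_log_max_le d (T : measurableType d) (R : realType)
    (P : probability T R) (A : nat -> {RV P >-> borelC R}) (t : R) (n : nat)
    (c : R) :
  identically_distributed P A -> (0 < t)%R -> (0 < c)%R ->
  n.+1%:R%:E * \int[P]_w (Normc.normc (A 0%N w) `^ t)%:E <= c%:E ->
  let logY w :=
    lne (\big[Num.max/0]_(k < n.+1) Normc.normc (A k w))%R%:E in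
  \int[P]_w logY^\+ w < +oo /\ \int[P]_w logY w <= (ln c / t)%:E.
Proof.
move=> idA t0 c0 muc logY.
pose f k w := (Normc.normc (A k w) `^ t)%R.
have mf k : measurable_fun setT (EFin \o f k).
  exact: (measurableT_comp (measurable_powR_normc R t)).
have muf k : \int[P]_w (f k w)%:E = \int[P]_w (f 0%N w)%:E.
  apply: (ge0_integral_identically_distributed _ _ _ _ _ _ _ _ _ k 0%N idA
    (measurable_powR_normc R t)) => z.
  by rewrite lee_fin powR_ge0.
pose S w := (\sum_(k < n.+1) f k w)%R.
have S0 w : (0 <= S w)%R by apply: sumr_ge0 => k _; exact: powR_ge0.
have mS : measurable_fun setT (EFin \o S).
  apply/measurable_EFinP; apply: measurable_sum => k.
  by apply/measurable_EFinP; exact: mf.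
have intS : \int[P]_w (S w)%:E <= c%:E.
  apply: le_trans muc; under eq_integral do rewrite /S -sumEFin.
  rewrite ge0_integral_sum//=; last 2 first.
  - by move=> k; exact: mf.
  - by move=> k w _; rewrite lee_fin powR_ge0.
  under eq_bigr do rewrite muf.
  by rewrite sumr_const card_ord mule_natl.
have iS : P.-integrable setT (EFin \o S).
  apply/integrableP; split => //.
  under eq_integral do rewrite gee0_abs ?lee_fin//.
  exact: le_lt_trans intS (ltry _).
(* the tangent bound at [c] for [log (S w)], divided by [t] *)
pose g w := ((c * t)^-1)%:E * (S w)%:E + ((ln c - 1) / t)%:E.
have iZ : P.-integrable setT (fun w => ((c * t)^-1)%:E * (S w)%:E).
  exact: integrableZl.
have icst : P.-integrable setT (cst ((ln c - 1) / t)%:E).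
  exact: finite_measure_integrable_cst.
have ig : P.-integrable setT g by exact: integrableD.
have logYg w : logY w <= g w.
  rewrite /logY /g /=; case: ifPn => [_|]; first exact: leNye.
  rewrite -ltNge -EFinM -EFinD lee_fin.
  set y := (\big[_/_]_(k < _) _)%R => y0.
  have yS : (y `^ t <= S w)%R.
    have [k yk] : exists k : 'I_n.+1, y = Normc.normc (A k w).
      have [//|i _|k _ yk] := @Order.TotalTheory.eq_bigmax _ _ _ 0%R ord0 xpredT
        (fun k : 'I_n.+1 => Normc.normc (A k w)); first exact: normc_ge0.
      by exists k.
    rewrite yk /S (bigD1 k)//= lerDl.
    by apply: sumr_ge0 => j _; exact: powR_ge0.
  rewrite -(ler_pM2l t0) -ln_powR.
  apply: le_trans (@ln_le_tangent _ c _ c0 (powR_gt0 t y0)) _.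
  rewrite (_ : (t * _ = S w / c - 1 + ln c)%R); last by field; rewrite !gt_eqF.
  by rewrite !lerD2r ler_pM2r ?invr_gt0.
have logYpos : \int[P]_w logY^\+ w <= \int[P]_w g^\+ w.
  apply: le_integral_nonmeasurable => w.
  by apply: (@funepos_le _ _ setT) => [? _|]; rewrite ?inE.
split.
  apply: le_lt_trans logYpos _.
  by rewrite ltey_eq integrable_pos_fin_num.
apply: le_trans (le_integral_nonmeasurable _ _ _ _ _ _ logYg) _.
have PT : \int[P]_w ((ln c - 1) / t)%:E = ((ln c - 1) / t)%:E.
  by rewrite integral_cst//= probability_setT mule1.
rewrite integralD// integralZl// PT.
apply: (@le_trans _ _ (((c * t)^-1)%:E * c%:E + ((ln c - 1) / t)%:E)).
  apply: leeD2r; apply: lee_wpmul2l => //.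
  by rewrite lee_fin invr_ge0 ltW// mulr_gt0.
rewrite -EFinM -EFinD lee_fin.
by rewrite le_eqVlt; apply/orP; left; apply/eqP; field; rewrite !gt_eqF.
Qed.

Theorem proposition4p1 (d : measure_display) (T : measurableType d)
  (R : realType) (P : probability T R) (A : nat -> {RV P >-> borelC R})
  (n : nat) (t : R) :
  iid P A ->
  (0 < t)%R ->
  (* the moduli are nonnegative, so the default value 0 of the maximum is
     harmless *)
  let Y : T -> R :=
    fun w => (\big[Num.max/0]_(k < n.+1) Normc.normc (A k w))%R in
  let logY : T -> \bar R := fun w => lne (Y w)%:E in
  let mu : \bar R := 'E_P[fun w => (Normc.normc (A 0%N w) `^ t)%R] in
  mu < +oo ->
  (* logY is -oo where Y vanishes; the first conjunct says that its expectation
     is well defined in [-oo, +oo[ *)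
  \int[P]_w logY^\+ w < +oo /\
  \int[P]_w logY w <= ((ln n.+1%:R)%:E + lne mu) / t%:E.
Proof.
move=> [_ idA] t0 Y logY mu mufin.
have muE : mu = \int[P]_w (Normc.normc (A 0%N w) `^ t)%:E.
  by rewrite /mu unlock.
have mu0 : 0 <= mu.
  by rewrite muE; apply: integral_ge0 => w _; rewrite lee_fin powR_ge0.
have bound := @expectation_log_max_le _ _ _ P A t n _ idA t0.
rewrite -muE in bound.
move: mufin mu0 bound; case: mu {muE} => // m _; rewrite lee_fin => m0 bound.
have [m1|m_le0] := ltP 0%R m.
- have c0 : (0 < n.+1%:R * m)%R by rewrite mulr_gt0.
  have [|pos le] := bound _ c0; first by rewrite -EFinM.
  split => //; apply: le_trans le _.
  rewrite lne_EFin// inver gt_eqF// -EFinD -EFinM lee_fin.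
  by rewrite lnM ?posrE.
- have {m0 m_le0} m0 : m = 0%R by apply/eqP; rewrite eq_le m_le0.
  have all M : (0 < expR M)%R /\ n.+1%:R%:E * m%:E <= (expR M)%:E.
    by rewrite expR_gt0 m0 mule0 lee_fin expR_ge0.
  split.
    by have [c0 /(bound _ c0)[]] := all 0%R.
  rewrite [leRHS](_ : _ = -oo); last first.
    by rewrite m0 /= lexx /= inver gt_eqF// gt0_mulNye// lte_fin invr_gt0.
  (* Taking [c = expR (- M * t)] bounds the integral by [- M], for every [M]. *)
  rewrite leeNy_eq -[X in X == _]oppeK eqe_oppLR /=; apply/eqP/eq_infty => M.
  have [c0 /(bound _ c0)[_]] := all (- M * t)%R.
  by rewrite expRK mulfK ?gt_eqF// EFinN leeNr.
Qed.
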